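(* Let $(M,\mathfrak g,T)$ be an embedding tensor on a Malcev algebra $\mathfrak g$, with action $\rho$ of $\mathfrak g$ on $M$, and let $(\rho_1,\rho_2,\rho_3)$ be a representation of $(M,\mathfrak g,T)$ on $(V,W,T')$. Define, for $m\in M$, $v\in V$, $x,y\in\mathfrak g$, $w,w_1,w_2\in W$, $$\widehat T(m+v):=T(m)+T'(v),$$ $$[x+w_1,\,y+w_2]:=[x,y]+\rho_2(x)(w_2)-\rho_2(y)(w_1),$$ $$\widehat\rho(x+w)(m+v):=\rho(x)(m)+\rho_1(x)(v)-\rho_3(m)(w).$$ Then $(M\oplus V,\ \mathfrak g\oplus W,\ \widehat T)$, with this bracket on $\mathfrak g\oplus W$ and this action $\widehat\rho$ of $\mathfrak g\oplus W$ on $M\oplus V$, is an embedding tensor on a Malcev algebra; that is, $\mathfrak g\oplus W$ is a Malcev algebra, $\widehat\rho$ is a representation of it on $M\oplus V$, and $\widehat T$ is an embedding tensor operator.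
   Context: All vector spaces and linear maps are over a fixed field of characteristic $0$. A Malcev algebra is a vector space $\mathfrak g$ with a skew-symmetric bilinear bracket $[\cdot,\cdot]$ satisfying $J(x,y,[x,z])=[J(x,y,z),x]$ for all $x,y,z\in\mathfrak g$, where $J(x,y,z)=[[x,y],z]+[[y,z],x]+[[z,x],y]$. A representation of $\mathfrak g$ on a vector space $M$ is a linear map $\rho:\mathfrak g\to\operatorname{End}(M)$ such that for all $x,y,z\in\mathfrak g$ $$\rho([[x,y],z])=\rho(x)\rho(y)\rho(z)-\rho(z)\rho(x)\rho(y)+\rho(y)\rho([z,x])-\rho([y,z])\rho(x).$$ Given a representation $(M,\rho)$ of $\mathfrak g$, an embedding tensor operator is a linear map $T:M\to\mathfrak g$ with $[T(m),T(n)]=T(\rho(T(m))(n))$ for all $m,n\in M$; then $(M,\mathfrak g,T)$ is called an embedding tensor on the Malcev algebra $\mathfrak g$. A representation $(\rho_1,\rho_2,\rho_3)$ of $(M,\mathfrak g,T)$ on $(V,W,T')$, where $V,W$ are vector spaces and $T':V\to W$ is linear, consists of the following data satisfying, for all $x,y\in\mathfrak g$, $m\in M$, $v\in V$, $w\in W$: (i) $\rho_1$ and $\rho_2$ are representations of the Malcev algebra $\mathfrak g$ on $V$ and $W$ respectively; (ii) $T'(\rho_1(x)(v))=\rho_2(x)(T'(v))$; (iii) $\rho_3:M\to\operatorname{Hom}(W,V)$ is a linear map with $\rho_2(T(m))(T'(v))=T'\big(\rho_3(m)(T'(v))\big)$; (iv) $$\rho_3(m)\rho_2(x)\rho_2(y)(w)-\rho_1(x)\rho_1(y)\rho_3(m)(w)+\rho_1(y)\rho_3(\rho(x)(m))(w)+\rho_3(\rho(y)(m))\rho_2(x)(w)+\rho_3(\rho([x,y])(m))(w)=0,$$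 $$\rho_3(m)\rho_2([x,y])(w)-\rho_1(x)\rho_1(y)\rho_3(m)(w)+\rho_3(\rho(x)\rho(y)(m))(w)+\rho_1(y)\rho_3(m)\rho_2(x)(w)+\rho_3(\rho(x)(m))\rho_2(y)(w)=0,$$ $$\rho_3(m)\rho_2(x)\rho_2(y)(w)-\rho_3(\rho(y)\rho(x)(m))(w)+\rho_1(x)\rho_3(\rho(y)(m))(w)-\rho_1(y)\rho_3(m)\rho_2(x)(w)+\rho_1([y,x])\rho_3(m)(w)=0.$$ *)

(* Defs.v *)
From HB Require Import structures.
From mathcomp Require Import all_boot all_algebra.

Set Implicit Arguments.
Unset Strict Implicit.
Unset Printing Implicit Defensive.

Import GRing.Theory.

Local Open Scope ring_scope.

(* Vector spaces over K are lmodTypes, of arbitrary dimension. Since the linear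
   maps between two lmodTypes do not form an lmodType in the library, a linear
   map A -> Hom(B, C) is represented by its curried form A -> B -> C, linear in
   each argument. *)
Definition is_bilinear (K : fieldType) (A B C : lmodType K)
    (f : A -> B -> C) : Prop :=
  (forall b : B, linear (f^~ b)) /\ (forall a : A, linear (f a)).

Definition jacobian (K : fieldType) (g : lmodType K) (br : g -> g -> g)
    (x y z : g) : g :=
  br (br x y) z + br (br y z) x + br (br z x) y.

Record malcev_algebra (K : fieldType) (g : lmodType K) (br : g -> g -> g)
    : Prop := MalcevAlgebra {
  malcev_bilinear : is_bilinear br;
  malcev_skew : forall x y, br x y = - br y x;
  malcev_identity : forall x y z,
    jacobian br x y (br x z) = br (jacobian br x y z) x
}.

Record malcev_repr (K : fieldType) (g M : lmodType K) (br : g -> g -> g)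
    (rho : g -> M -> M) : Prop := MalcevRepr {
  malcev_repr_bilinear : is_bilinear rho;
  malcev_repr_identity : forall x y z m,
    rho (br (br x y) z) m =
      rho x (rho y (rho z m)) - rho z (rho x (rho y m))
      + rho y (rho (br z x) m) - rho (br y z) (rho x m)
}.

Record embedding_tensor_operator (K : fieldType) (g M : lmodType K)
    (br : g -> g -> g) (rho : g -> M -> M) (T : M -> g)
    : Prop := EmbeddingTensorOperator {
  eto_linear : linear T;
  eto_identity : forall m n, br (T m) (T n) = T (rho (T m) n)
}.

Record embedding_tensor (K : fieldType) (g M : lmodType K)
    (br : g -> g -> g) (rho : g -> M -> M) (T : M -> g)
    : Prop := EmbeddingTensor {
  et_malcev : malcev_algebra br;
  et_repr : malcev_repr br rho;
  et_operator : embedding_tensor_operator br rho T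
}.

Record embedding_tensor_repr (K : fieldType) (g M V W : lmodType K)
    (br : g -> g -> g) (rho : g -> M -> M) (T : M -> g) (T' : V -> W)
    (rho1 : g -> V -> V) (rho2 : g -> W -> W) (rho3 : M -> W -> V)
    : Prop := EmbeddingTensorRepr {
  etr_linear : linear T';
  etr_rho1 : malcev_repr br rho1;
  etr_rho2 : malcev_repr br rho2;
  etr_equivariant : forall x v, T' (rho1 x v) = rho2 x (T' v);
  etr_rho3 : is_bilinear rho3;
  etr_compat : forall m v, rho2 (T m) (T' v) = T' (rho3 m (T' v));
  etr_identity1 : forall x y m w,
    rho3 m (rho2 x (rho2 y w)) - rho1 x (rho1 y (rho3 m w))
    + rho1 y (rho3 (rho x m) w) + rho3 (rho y m) (rho2 x w)
    + rho3 (rho (br x y) m) w = 0;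
  etr_identity2 : forall x y m w,
    rho3 m (rho2 (br x y) w) - rho1 x (rho1 y (rho3 m w))
    + rho3 (rho x (rho y m)) w + rho1 y (rho3 m (rho2 x w))
    + rho3 (rho x m) (rho2 y w) = 0;
  etr_identity3 : forall x y m w,
    rho3 m (rho2 x (rho2 y w)) - rho3 (rho y (rho x m)) w
    + rho1 x (rho3 (rho y m) w) - rho1 y (rho3 m (rho2 x w))
    + rho1 (br y x) (rho3 m w) = 0
}.

(* A direct sum A \oplus B is the product lmodType A * B; a + b is (a, b). *)
Definition hat_T (K : fieldType) (g M V W : lmodType K)
    (T : M -> g) (T' : V -> W) (p : M * V) : g * W :=
  (T p.1, T' p.2).

Definition hat_bracket (K : fieldType) (g W : lmodType K)
    (br : g -> g -> g) (rho2 : g -> W -> W) (p q : g * W) : g * W :=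
  (br p.1 q.1, rho2 p.1 q.2 - rho2 q.1 p.2).

Definition hat_rho (K : fieldType) (g M V W : lmodType K)
    (rho : g -> M -> M) (rho1 : g -> V -> V) (rho3 : M -> W -> V)
    (a : g * W) (p : M * V) : M * V :=
  (rho a.1 p.1, rho1 a.1 p.2 - rho3 p.1 a.2).

(* Main.v *)
Require Import Defs.
From mathcomp Require Import all_boot all_algebra.

(** Write [g + W] for the semidirect product, in which [W] has zero products.
    Every identity to be proved splits along the two direct sums.  The first
    components are hypotheses.  In the second components each
    monomial contains exactly one vector taken from [W] or [V], so the identity
    separates into one operator identity for each argument that supplies this
    vector, and each of these is a combination of hypotheses.

    - [g + W] is a Malcev algebra ([hat_bracket_malcev]).  Write [I(x,y,z)] for
      the representation identity expanding [rho2 [[x,y],z]].  In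
      [J(X,Y,[X,Z]) = [J(X,Y,Z),X]], with [x], [y], [z] the components in [g],
      the terms in the [W]-part of [Z] amount to [I(x,x,y)], those in the
      [W]-part of [Y] to [I(x,z,x)], and those in the [W]-part of [X] to
      [I(x,y,z)] plus [I(y,z,x)] minus the symmetrized identity
      [I(x,z,y) + I(z,x,y)], whose left-hand side vanishes by skew-symmetry.
      Terms in two [W]-parts do not occur, although [X] appears twice, since
      [W] multiplies to zero.  Characteristic different from 2 enters through
      [[x,x] = 0].
    - [hat_rho] is a representation ([hat_rho_repr]).  The terms in the
      [W]-parts of [X], [Y], [Z] are the third, first and second compatibility
      identities between [rho3] and the actions, at [(z,y)], [(z,x)], [(x,y)].
    - [hat_T] is an embedding tensor operator ([hat_T_operator]) because [T']
      intertwines [rho1] with [rho2], and [rho3 n] with [rho2 (T n)] on the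
      image of [T'].

    Once the right instances are named, what is left is the cancellation of
    terms in an abelian group, decided by the reflexive tactic [abel]. *)

Set Implicit Arguments.
Unset Strict Implicit.
Unset Printing Implicit Defensive.

Import GRing.Theory.

Local Open Scope ring_scope.

(** * Deciding identities in abelian groups *)

Inductive zexpr : Type :=
  | ZVar of nat
  | ZZero
  | ZAdd of zexpr & zexpr
  | ZOpp of zexpr.

Fixpoint zeval (V : zmodType) (env : seq V) (e : zexpr) : V :=
  match e with
  | ZVar i => env`_i
  | ZZero => 0
  | ZAdd e1 e2 => zeval env e1 + zeval env e2
  | ZOpp e1 => - zeval env e1
  end.

Fixpoint zcoef (e : zexpr) (i : nat) : int :=
  match e with
  | ZVar j => (i == j)%:Z
  | ZZero => 0
  | ZAdd e1 e2 => zcoef e1 i + zcoef e2 i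
  | ZOpp e1 => - zcoef e1 i
  end.

(** This holds for every expression because variables beyond the environment
    evaluate to the default 0. *)
Lemma zeval_sum (V : zmodType) (env : seq V) e :
  zeval env e = \sum_(i < size env) env`_i *~ zcoef e i.
Proof.
elim: e => [j||e1 IH1 e2 IH2|e IH] /=.
- have [lt_j|ge_j] := ltnP j (size env).
    rewrite (bigD1 (Ordinal lt_j)) //= eqxx mulr1z big1 ?addr0 // => i ne_ij.
    by move: ne_ij; rewrite -val_eqE /= => /negPf->; rewrite mulr0z.
  rewrite nth_default // big1 // => i _.
  by rewrite (ltn_eqF (leq_trans (ltn_ord i) ge_j)) mulr0z.
- by rewrite big1 // => i _; rewrite mulr0z.
- by rewrite IH1 IH2 -big_split; apply: eq_bigr => i _; rewrite mulrzDr.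
- by rewrite IH -sumrN; apply: eq_bigr => i _; rewrite mulrNz.
Qed.

(** The premise is closed once the expressions are reified, whatever [V] is, so
    it is settled by computation. *)
Lemma zeval_eq (V : zmodType) (env : seq V) e1 e2 :
  all (fun i => zcoef e1 i == zcoef e2 i) (iota 0 (size env)) ->
  zeval env e1 = zeval env e2.
Proof.
move/allP=> eq_coef; rewrite !zeval_sum; apply: eq_bigr => i _.
by rewrite (eqP (eq_coef i _)) // mem_iota /=.
Qed.

Ltac zindex x env :=
  lazymatch env with
  | x :: _ => constr:(0%N)
  | _ :: ?env' => let n := zindex x env' in constr:(S n)
  end.

Ltac zatoms t env :=
  lazymatch t with
  | @GRing.zero _ => env
  | @GRing.add _ ?a ?b => let env' := zatoms a env in zatoms b env'
  | @GRing.opp _ ?a => zatoms a env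
  | _ => match env with
         | _ => let _ := zindex t env in env
         | _ => constr:(t :: env)
         end
  end.

Ltac zreify t env :=
  lazymatch t with
  | @GRing.zero _ => constr:(ZZero)
  | @GRing.add _ ?a ?b =>
      let ea := zreify a env in let eb := zreify b env in constr:(ZAdd ea eb)
  | @GRing.opp _ ?a => let ea := zreify a env in constr:(ZOpp ea)
  | _ => let n := zindex t env in constr:(ZVar n)
  end.

(** Proves [a = b] when both sides have the same coefficients on every maximal
    subterm that is not itself a sum, an opposite or zero. *)
Ltac abel :=
  lazymatch goal with
  | |- @eq ?V ?a ?b =>
      let env0 := zatoms a (@nil V) in
      let env := zatoms b env0 in
      let ea := zreify a env in
      let eb := zreify b env in
      apply: (@zeval_eq _ env ea eb); vm_compute; reflexivity
  end.

(** Reduces an equation that follows from a linear combination [a = b] of known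
    ones to a formal identity, in the range of [abel]. *)
Lemma eq_of_sub_eq (V : zmodType) (a b l r : V) :
  a = b -> l - r = a - b -> l = r.
Proof. by move=> -> /eqP; rewrite subrr subr_eq0 => /eqP. Qed.

(** * Additivity of linear and bilinear maps *)

Lemma linear_rules (K : fieldType) (A B : lmodType K) (f : A -> B) : linear f ->
  ((forall u v, f (u + v)%R = (f u + f v)%R) * (forall u, f (- u)%R = - f u) *
   (f 0 = 0))%type.
Proof.
move=> lin_f.
have fD u v : f (u + v) = f u + f v by have := lin_f 1 u v; rewrite !scale1r.
have f0 : f 0 = 0 by apply: (addIr (f 0)); rewrite -fD !add0r.
by split=> //; split=> // u; apply: (addIr (f u)); rewrite -fD !addNr.
Qed.

Section Bilinear.

Variables (K : fieldType) (A B C : lmodType K).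

Lemma bilinear_rules (f : A -> B -> C) : is_bilinear f ->
  ((forall a u v, f a (u + v)%R = (f a u + f a v)%R) *
   (forall a u, f a (- u)%R = - f a u) * (forall a, f a 0 = 0) *
   (forall u v b, f (u + v)%R b = (f u b + f v b)%R) *
   (forall u b, f (- u)%R b = - f u b) * (forall b, f 0 b = 0))%type.
Proof.
case=> fl fr; have lin_fr a := linear_rules (fr a).
have lin_fl b := linear_rules (fl b).
by do 5?split=> *; rewrite ?(lin_fr, lin_fl).
Qed.

Lemma bilinear_scale (f : A -> B -> C) : is_bilinear f ->
  ((forall k a u, f a (k *: u) = k *: f a u) *
   (forall k u b, f (k *: u) b = k *: f u b))%type.
Proof.
move=> bil_f; have fE := bilinear_rules bil_f; case: (bil_f) => fl fr.
split=> [k a u|k u b]; first by rewrite -[k *: u]addr0 fr fE addr0.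
by rewrite -[k *: u]addr0 fl fE addr0.
Qed.

End Bilinear.

(** * The semidirect product of a Malcev algebra with a representation *)

Section SemidirectProduct.

Variables (K : fieldType) (g W : lmodType K).
Variables (br : g -> g -> g) (rho2 : g -> W -> W).
Hypothesis charK0 : [pchar K] =i pred0.
Hypothesis malcev_g : malcev_algebra br.
Hypothesis repr_W : malcev_repr br rho2.

Lemma malcev_bracket_self x : br x x = 0.
Proof.
have two_neq0 : 2%:R != 0 :> K by move/pcharf0P: charK0 => ->.
have double0 : 2%:R *: br x x = 0.
  by rewrite scaler_nat mulr2n {1}(malcev_skew malcev_g) addNr.
by apply/eqP; move/eqP: double0; rewrite scaler_eq0 (negPf two_neq0).
Qed.

Lemma hat_bracket_bilinear : is_bilinear (hat_bracket br rho2).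
Proof.
have brE := bilinear_rules (malcev_bilinear malcev_g).
have brZ := bilinear_scale (malcev_bilinear malcev_g).
have rE := bilinear_rules (malcev_repr_bilinear repr_W).
have rZ := bilinear_scale (malcev_repr_bilinear repr_W).
split=> [[b1 b2] k [x1 x2] [y1 y2]|[b1 b2] k [x1 x2] [y1 y2]];
  by congr pair; rewrite /= !(brE, rE) !(brZ, rZ) ?scalerBr //; abel.
Qed.

(** The representation identity yields the operator identities on [W] that the
    Malcev identity of the semidirect product demands, one for each argument
    taken in [W]. *)
Lemma hat_bracket_malcev : malcev_algebra (hat_bracket br rho2).
Proof.
have brE := bilinear_rules (malcev_bilinear malcev_g).
have rE := bilinear_rules (malcev_repr_bilinear repr_W).
have skew := malcev_skew malcev_g.
have rI := malcev_repr_identity repr_W.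
split; first exact: hat_bracket_bilinear.
  by move=> [x a] [y b]; congr pair; rewrite /= ?opprB // -skew.
move=> [x a] [y b] [z c]; congr pair; first exact: (malcev_identity malcev_g).
have Ic : rho2 (br (br x x) y) c = 0 by rewrite malcev_bracket_self brE rE.
(* The sum of Ia1 and Ia2 expands only two terms of the jacobian of x, y, z, the
   third being [y,[x,z]] on the other side; what is left cancels against this
   symmetrization. *)
have Ia3 : rho2 (br (br x z) y) a + rho2 (br (br z x) y) a = 0.
  by rewrite (skew z x) !(brE, rE) subrr.
have Ib := rI x z x b.
have Ia1 := rI x y z a.
have Ia2 := rI y z x a.
rewrite rI in Ic; rewrite !rI in Ia3.
(* The orientations of the summands are the signs of the combination. *)
apply/esym; rewrite /jacobian /=.
apply: (eq_of_sub_eq (f_equal2 +%R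
  (f_equal2 +%R (f_equal2 +%R Ia1 Ia2) (esym Ia3)) (f_equal2 +%R (esym Ib) Ic))).
(* Orient all brackets alike, so that equal monomials are equal atoms. *)
rewrite (skew y (br x z)) (skew z x) (skew z y) (skew y x).
by rewrite malcev_bracket_self !(brE, rE); abel.
Qed.

End SemidirectProduct.

(** * The representation of the semidirect product *)

Section SemidirectRepresentation.

Variables (K : fieldType) (g M V W : lmodType K).
Variables (br : g -> g -> g) (rho : g -> M -> M) (T : M -> g) (T' : V -> W).
Variables (rho1 : g -> V -> V) (rho2 : g -> W -> W) (rho3 : M -> W -> V).
Hypothesis repr_M : malcev_repr br rho.
Hypothesis repr_T : embedding_tensor_repr br rho T T' rho1 rho2 rho3.

Lemma hat_rho_bilinear : is_bilinear (hat_rho rho rho1 rho3).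
Proof.
have bil_rho := malcev_repr_bilinear repr_M.
have bil_rho1 := malcev_repr_bilinear (etr_rho1 repr_T).
have bil_rho3 := etr_rho3 repr_T.
have [rE r1E r3E] := And3 (bilinear_rules bil_rho) (bilinear_rules bil_rho1)
  (bilinear_rules bil_rho3).
have [rZ r1Z r3Z] := And3 (bilinear_scale bil_rho) (bilinear_scale bil_rho1)
  (bilinear_scale bil_rho3).
split=> [[m v] k [x a] [y b]|[x a] k [m v] [n u]];
  by congr pair; rewrite /= !(rE, r1E, r3E) !(rZ, r1Z, r3Z) ?scalerBr //; abel.
Qed.

(** The [V]-component of [hat_rho [[X,Y],Z]] has one term in [v], governed by
    the identity of [rho1], and terms through [rho3 m] in the three [W]-parts,
    each governed by one of the three compatibility identities. *)
Lemma hat_rho_repr :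
  malcev_repr (hat_bracket br rho2) (hat_rho rho rho1 rho3).
Proof.
split; first exact: hat_rho_bilinear.
have r1E := bilinear_rules (malcev_repr_bilinear (etr_rho1 repr_T)).
have r2E := bilinear_rules (malcev_repr_bilinear (etr_rho2 repr_T)).
have r3E := bilinear_rules (etr_rho3 repr_T).
move=> [x a] [y b] [z c] [m v]; congr pair.
  exact: (malcev_repr_identity repr_M).
have Iv := malcev_repr_identity (etr_rho1 repr_T) x y z v.
have Ia := etr_identity3 repr_T z y m a.
have Ib := etr_identity1 repr_T z x m b.
have Ic := etr_identity2 repr_T x y m c.
apply: (eq_of_sub_eq (f_equal2 +%R (f_equal2 +%R Iv (esym Ia))
  (f_equal2 +%R Ib (esym Ic)))).
by rewrite /= !(r1E, r2E, r3E); abel.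
Qed.

(** On the image of [hat_T] only vectors [T' v] are fed to [rho3], which is why
    the compatibility of [rho3] with [T'] on that image suffices. *)
Lemma hat_T_operator : embedding_tensor_operator br rho T ->
  embedding_tensor_operator (hat_bracket br rho2) (hat_rho rho rho1 rho3)
    (hat_T T T').
Proof.
have T'E := linear_rules (etr_linear repr_T).
case=> lin_T T_eq; split=> [k [m v] [n u]|[m v] [n u]]; congr pair.
- exact: lin_T k m n.
- exact: etr_linear repr_T k v u.
- exact: T_eq.
- by rewrite /= !T'E (etr_equivariant repr_T) -(etr_compat repr_T).
Qed.

End SemidirectRepresentation.

Theorem proposition3p2 (K : fieldType) (charK0 : [pchar K] =i pred0)
    (g M V W : lmodType K)
    (br : g -> g -> g) (rho : g -> M -> M) (T : M -> g) (T' : V -> W)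
    (rho1 : g -> V -> V) (rho2 : g -> W -> W) (rho3 : M -> W -> V) :
  embedding_tensor br rho T ->
  embedding_tensor_repr br rho T T' rho1 rho2 rho3 ->
  embedding_tensor (hat_bracket br rho2) (hat_rho rho rho1 rho3) (hat_T T T').
Proof.
case=> malcev_g repr_M oper_T repr_T; split.
- exact: (hat_bracket_malcev charK0 malcev_g (etr_rho2 repr_T)).
- exact: (hat_rho_repr repr_M repr_T).
- exact: (hat_T_operator repr_T oper_T).
Qed.
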